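(* Let $s\geqslant 1$ and let $T=G_1G_2\cdots G_{2s}$ be a Gauss factorization of a tangram $T$ with Gauss pattern $G=g_1g_2\cdots g_{2s}$. Then there exists a pair of twins $G_i=G_j=X$, $i<j$, within distance at most $s|X|$. Moreover, this distance is strictly smaller than $s|X|$, unless $G$ is a square and all factors $G_m$, with $1\leqslant m\leqslant 2s$, are of the same length.
   Context: Words are finite sequences of letters; $|W|$ denotes the length of a word $W$. A tangram is a word in which every letter occurs an even number of times (possibly zero). A square is a word of the form $UU$ with $U$ a nonempty word. A Gauss word is a tangram in which every letter that occurs in it occurs exactly twice. Let $W=F_1F_2\cdots F_n$ be a factorization of a word $W$ into nonempty factors. A word $P=p_1p_2\cdots p_n$ is a pattern of this factorization if, for each pair of indices $i\neq j$, $p_i=p_j$ if and only if $F_i=F_j$. A Gauss factorization is a factorization whose pattern is a Gauss word; this pattern is then called its Gauss pattern. In a Gauss factorization $T=G_1G_2\cdots G_{2s}$, a pair of equal factors $G_i=G_j$ with $i\neq j$ is called a pair of twins. For $i<j$, the distance between the twins $G_i$ and $G_j$ is $p_j-p_i$, where $p_m=1+\sum_{h<m}|G_h|$ is the position in $T$ at which the factor $G_m$ of the factorization begins. *)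

(* Defs.v *)
From mathcomp Require Import all_boot.

Set Implicit Arguments.
Unset Strict Implicit.
Unset Printing Implicit Defensive.

Definition tangram (A : eqType) (w : seq A) : Prop :=
  forall a : A, ~~ odd (count_mem a w).

Definition square (A : eqType) (w : seq A) : Prop :=
  exists2 u : seq A, u <> [::] & w = u ++ u.

Definition gauss_word (A : eqType) (w : seq A) : Prop :=
  tangram w /\ (forall a : A, a \in w -> count_mem a w = 2).

Definition factorization (A : eqType) (n : nat) (w : seq A)
    (F : n.-tuple (seq A)) : Prop :=
  flatten F = w /\ (forall i : 'I_n, tnth F i <> [::]).

(* The letters of a pattern need not belong to the alphabet of the word. *)
Definition pattern (A B : eqType) (n : nat) (F : n.-tuple (seq A))
    (P : n.-tuple B) : Prop :=
  forall i j : 'I_n, i != j -> (tnth P i = tnth P j <-> tnth F i = tnth F j).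

(* F is a Gauss factorization of w, with Gauss pattern P. *)
Definition gauss_factorization (A B : eqType) (n : nat) (w : seq A)
    (F : n.-tuple (seq A)) (P : n.-tuple B) : Prop :=
  [/\ factorization w F, pattern F P & gauss_word P].

Definition twins (A : eqType) (n : nat) (F : n.-tuple (seq A))
    (i j : 'I_n) : Prop :=
  i != j /\ tnth F i = tnth F j.

(* Factors are indexed from 0, but positions in the word start at 1. *)
Definition start_pos (A : eqType) (n : nat) (F : n.-tuple (seq A))
    (m : 'I_n) : nat :=
  1 + \sum_(h < n | h < m) size (tnth F h).

(* The subtraction is truncated: this is the distance only when i <= j. *)
Definition distance (A : eqType) (n : nat) (F : n.-tuple (seq A))
    (i j : 'I_n) : nat :=
  start_pos F j - start_pos F i.

(* Main.v *)
(** Let x_k and d_k be the common length and the distance of the k-th pair of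
    twins. Expanding each d_k as a sum of lengths of factors, two distinct pairs
    k, l contribute to sum_k x_k d_k at most 2 x_k x_l: twice if they are nested
    or interlaced, not at all if they are disjoint. Hence
    sum_k x_k d_k <= (sum_k x_k)^2 <= s sum_k x_k^2 by Cauchy-Schwarz, so some
    d_k is at most s x_k. If no d_k is smaller than s x_k, all these are
    equalities: the lengths are equal, and then twins are s factors apart. *)

Require Import Defs.
From mathcomp Require Import all_boot zify.

Set Implicit Arguments.
Unset Strict Implicit.
Unset Printing Implicit Defensive.

(** Encodes the pairs of twins as a fixed-point-free involution, so that sums over pairs become sums
    over all indices, each pair being counted twice. *)
Lemma gauss_word_involution (B : eqType) (n : nat) (G : n.-tuple B) :
  gauss_word G ->
  exists sigma : 'I_n -> 'I_n,
    [/\ involutive sigma, forall i, sigma i != i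
      & forall i, tnth G (sigma i) = tnth G i].
Proof.
move=> [_ G2].
have card2 i : #|[set j | tnth G j == tnth G i]| = 2.
  rewrite -(G2 (tnth G i)) ?mem_tnth // -[in RHS](map_tnth_enum G) count_map.
  by rewrite cardsE cardE {1}/enum_mem size_filter -enumT.
have twinP i : exists j, (j != i) && (tnth G j == tnth G i).
  have /cards1P[j Ej] : #|[set j | tnth G j == tnth G i] :\ i| == 1.
    have := cardsD1 i [set j | tnth G j == tnth G i].
    by rewrite card2 inE eqxx; lia.
  by exists j; move: (set11 j); rewrite -Ej !inE.
pose sigma i := xchoose (twinP i).
have sigmaP i : (sigma i != i) && (tnth G (sigma i) == tnth G i).
  exact: xchooseP (twinP i).
exists sigma; split=> [i|i|i]; last 2 first.
- by case/andP: (sigmaP i).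
- by case/andP: (sigmaP i) => _ /eqP.
have [/andP[si_i /eqP Gsi] /andP[ssi_si /eqP Gssi]] :=
  (sigmaP i, sigmaP (sigma i)).
apply/eqP; apply: contraT => ssi_i.
(* Otherwise [i], [sigma i] and [sigma (sigma i)] would be three positions of one letter. *)
suff: #|[set i; sigma i] :|: [set sigma (sigma i)]| <= 2.
  rewrite setUC cardsU1 cards2 !inE negb_or ssi_i ssi_si.
  by rewrite (eq_sym i) si_i.
rewrite -(card2 i); apply/subset_leq_card/subsetP => j.
by rewrite !inE => /orP[/orP[]|] /eqP->; rewrite ?Gssi ?Gsi.
Qed.

(** Symmetric in [a] and [b], so either twin may come first. Half-open, since a distance counts the
    left twin's length but not the right one's. *)
Definition between (a b m : nat) : bool := (a <= m < b) || (b <= m < a).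

Lemma sum_between_le (n : nat) (sigma : 'I_n -> 'I_n) (x : 'I_n -> nat) :
    involutive sigma -> (forall i, sigma i != i) ->
    (forall i, x (sigma i) = x i) ->
  2 * \sum_i \sum_m x i * x m * between i (sigma i) m
    <= \sum_i \sum_m x i * x m.
Proof.
move=> sigmaK sigma_neq x_sigma.
set S := \sum_i \sum_m x i * x m * between i (sigma i) m.
have S_sigma : S = \sum_i \sum_m x i * x m * between i (sigma i) (sigma m).
  apply: eq_bigr => i _; rewrite (reindex_inj (inv_inj sigmaK)).
  by apply: eq_bigr => m _; rewrite x_sigma.
have swap (f : 'I_n -> 'I_n -> nat) :
    \sum_i \sum_m x i * x m * f i m = \sum_i \sum_m x i * x m * f m i.
  rewrite exchange_big; apply: eq_bigr => i _.
  by apply: eq_bigr => m _; rewrite (mulnC (x m)).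
have S_swap : S = \sum_i \sum_m x i * x m * between m (sigma m) i.
  exact: swap (fun i m => between i (sigma i) m).
have S_swap_sigma :
    S = \sum_i \sum_m x i * x m * between m (sigma m) (sigma i).
  rewrite S_sigma; exact: swap (fun i m => between i (sigma i) (sigma m)).
(* The four terms are the occurrences of the pair of m between the twins i,
   and those of the pair of i between the twins m. *)
have four_S : 4 * S = \sum_i \sum_m x i * x m *
    (between i (sigma i) m + between i (sigma i) (sigma m)
     + (between m (sigma m) i + between m (sigma m) (sigma i))).
  under eq_bigr => i _ do
    (under eq_bigr => m _ do rewrite !mulnDr; rewrite !big_split /=).
  by rewrite !big_split /= -S_sigma -S_swap -S_swap_sigma -/S; lia.
have le_2 : 4 * S <= 2 * \sum_i \sum_m x i * x m.
  rewrite four_S big_distrr /=; apply: leq_sum => i _.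
  rewrite big_distrr /=; apply: leq_sum => m _.
  rewrite (mulnC 2) leq_mul2l; apply/orP; right.
  have := sigma_neq i; have := sigma_neq m.
  (* When [m] lies in the pair of [i], the four terms still add up to 2: a half-open interval
     contains exactly one of its ends. *)
  have [-> | mi] := eqVneq m i; first by rewrite -val_eqE /between /=; lia.
  have [-> | msi] := eqVneq m (sigma i).
    by rewrite sigmaK -!val_eqE /between /=; lia.
  have smi : sigma m != i by rewrite (can2_eq sigmaK sigmaK).
  have smsi : sigma m != sigma i by rewrite (inj_eq (inv_inj sigmaK)).
  by move: mi msi smi smsi; rewrite -!val_eqE /between /=; lia.
lia.
Qed.

(** Cauchy-Schwarz with its equality case, from summing [2ab <= a^2 + b^2] over all ordered pairs of
    indices. *)
Lemma sum_mul_leqif (n : nat) (x : 'I_n -> nat) :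
  \sum_i \sum_j x i * x j <= n * \sum_i x i ^ 2
    ?= iff [forall i, forall j, x i == x j].
Proof.
have H : \sum_i \sum_j 2 * (x i * x j) <= \sum_i \sum_j (x i ^ 2 + x j ^ 2)
    ?= iff [forall i, forall j, x i == x j].
  by apply: leqif_sum => i _; apply: leqif_sum => j _; apply: nat_Cauchy.
have El : \sum_i \sum_j 2 * (x i * x j) = 2 * \sum_i \sum_j x i * x j.
  by rewrite big_distrr; apply: eq_bigr => i _; rewrite big_distrr.
have Er : \sum_i \sum_j (x i ^ 2 + x j ^ 2) = 2 * (n * \sum_i x i ^ 2).
  under eq_bigr => i _ do rewrite big_split sum_nat_const card_ord /=.
  by rewrite big_split sum_nat_const card_ord -big_distrr /=; lia.
by move: H; rewrite El Er (mono_leqif (fun m n => leq_pmul2l (m := 2) isT)).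
Qed.

Lemma distanceE (A : eqType) (n : nat) (F : n.-tuple (seq A)) (i j : 'I_n) :
  i <= j -> distance F i j = \sum_m size (tnth F m) * between i j m.
Proof.
move=> le_ij; rewrite /distance /start_pos subnDl.
rewrite [X in X - _]big_mkcond [X in _ - X]big_mkcond /=.
apply/eqP; rewrite -(eqn_add2r (\sum_(h < n) if h < i then size (tnth F h) else 0)).
rewrite subnK; last first.
  by apply: leq_sum => h _; case: (ltnP h i) => // hi; rewrite (leq_trans hi).
rewrite -big_split /=; apply/eqP/eq_bigr => h _; rewrite /between.
by case: (ltnP h i) => hi; case: (ltnP h j) => hj /=; lia.
Qed.

Lemma start_pos_const (A : eqType) (n x : nat) (F : n.-tuple (seq A)) :
  (forall m, size (tnth F m) = x) -> forall i, start_pos F i = 1 + i * x.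
Proof.
move=> Fx i; rewrite /start_pos; under eq_bigr do rewrite Fx.
by rewrite -(big_ord_widen _ (fun=> x) (ltnW (ltn_ord i))) sum_nat_const card_ord.
Qed.

Lemma square_half (B : eqType) (s : nat) (G : (2 * s).-tuple B) :
    0 < s -> (forall i j : 'I_(2 * s), j = i + s :> nat -> tnth G i = tnth G j) ->
  square G.
Proof.
move=> s_gt0 Gs; have size_takeG : size (take s G) = s.
  by rewrite size_takel ?size_tuple; lia.
exists (take s G); first by move=> /(congr1 size); rewrite size_takeG /=; lia.
rewrite -[LHS](cat_take_drop s); congr (_ ++ _); symmetry.
(* A default letter for [nth], available because [G] is nonempty. *)
have b : B by case: (tval G) (size_tuple G) => //= *; lia.
apply: (@eq_from_nth _ b); first by rewrite size_drop size_takeG size_tuple; lia.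
move=> i; rewrite size_takeG => i_lt; rewrite nth_drop nth_take //.
have [lt1 lt2] : i < 2 * s /\ s + i < 2 * s by lia.
have := Gs (Ordinal lt1) (Ordinal lt2) (addnC _ _).
by rewrite !(tnth_nth b).
Qed.

Theorem theorem5 (A B : eqType) (s : nat) (T : seq A)
    (F : (2 * s).-tuple (seq A)) (G : (2 * s).-tuple B)
    (s_ge1 : 1 <= s) (T_tangram : tangram T)
    (F_gauss : gauss_factorization T F G) :
  exists (X : seq A) (i j : 'I_(2 * s)),
    [/\ i < j,
        twins F i j,
        tnth F i = X /\ tnth F j = X,
        distance F i j <= s * size X
      & ~ (square G /\ (forall m m' : 'I_(2 * s),
                          size (tnth F m) = size (tnth F m'))) ->
        distance F i j < s * size X].
Proof.
case: F_gauss => -[_ F_neq0] FG.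
move=> /gauss_word_involution[sigma [sigmaK sigma_neq G_sigma]].
have F_sigma i : tnth F (sigma i) = tnth F i by apply/(FG _ _ (sigma_neq i)).
pose x i := size (tnth F i).
have x_gt0 i : 0 < x i by rewrite /x lt0n size_eq0; apply/eqP.
have x_sigma i : x (sigma i) = x i by rewrite /x F_sigma.
have twins_sigma i : twins F i (sigma i) by split; rewrite ?F_sigma // eq_sym.
(* A pair with strict inequality settles both claims. Otherwise every distance is at least
   [s * x i], and the exceptional case must be derived. *)
have [/existsP[i /andP[lt_i d_lt]] | /existsPn d_ge] :=
    boolP [exists i : 'I_(2 * s),
            (i < sigma i) && (distance F i (sigma i) < s * x i)].
  by exists (tnth F i), i, (sigma i); split; rewrite ?F_sigma // ltnW.
(* Unlike the truncated [distance], [D] takes the same value at both twins of a pair. *)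
pose D (i : 'I_(2 * s)) := \sum_m x m * between i (sigma i) m.
have DE (i : 'I_(2 * s)) : i < sigma i -> distance F i (sigma i) = D i.
  by move=> lt_i; rewrite distanceE // ltnW.
have D_sigma i : D (sigma i) = D i.
  by apply: eq_bigr => m _; rewrite sigmaK /between orbC.
have D_ge i : s * x i <= D i.
  wlog lt_i : i / i < sigma i => [IH|].
    have := sigma_neq i; rewrite -val_eqE neq_ltn => /orP[lt_i | /IH //].
    by rewrite -D_sigma -x_sigma IH // sigmaK.
  by have := d_ge i; rewrite lt_i -leqNgt DE.
have sum_D :
    \sum_i x i * D i = \sum_i \sum_m x i * x m * between i (sigma i) m.
  apply: eq_bigr => i _; rewrite big_distrr /=.
  by apply: eq_bigr => m _; rewrite mulnA.
have le1 := sum_between_le sigmaK sigma_neq x_sigma.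
have [le2 eq2] := sum_mul_leqif x.
have [le3 eq3] : \sum_i x i * (s * x i) <= \sum_i x i * D i
    ?= iff [forall i, x i * (s * x i) == x i * D i].
  by apply: leqif_sum => i _; split; rewrite // leq_mul2l D_ge orbT.
have sum_sq : \sum_i x i * (s * x i) = s * \sum_i x i ^ 2.
  by rewrite big_distrr /=; apply: eq_bigr => i _; rewrite mulnCA.
(* With sums over all [2 * s] indices, [le3], [le1] and [le2] form a chain from
   [2 * s * \sum_i x i ^ 2] back to itself, so each is an equality. *)
have {eq2} /forallP x_const : [forall i, forall j, x i == x j].
  by rewrite -eq2; apply/eqP; lia.
have {eq3} /forallP D_eq : [forall i, x i * (s * x i) == x i * D i].
  by rewrite -eq3; apply/eqP; lia.
have {}D_eq i : D i = s * x i.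
  by have := D_eq i; rewrite eqn_pmul2l // => /eqP.
have {}x_const i j : x i = x j by have /forallP/(_ j)/eqP := x_const i.
have sigmaE (i : 'I_(2 * s)) : i < sigma i -> sigma i = i + s :> nat.
  move=> lt_i; have := DE i lt_i.
  rewrite D_eq /distance !(start_pos_const (fun m => x_const m i)).
  by rewrite subnDl -mulnBl => /eqP; rewrite eqn_pmul2r // => /eqP; lia.
have G_square : square G.
  apply: square_half => // i j ij; suff -> : j = sigma i by rewrite G_sigma.
  (* If [i] were the second twin, then [i >= s], and [j = i + s] would be out of range. *)
  apply: val_inj => /=; have := sigma_neq i; rewrite -val_eqE neq_ltn => /orP[lt_i|].
    have := sigmaE (sigma i); rewrite sigmaK => /(_ lt_i).
    by have := ltn_ord j; lia.
  by move=> /sigmaE; lia.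
(* All pairs now attain equality; index 0 is a convenient witness, being necessarily a first
   twin. *)
have lt0 : 0 < 2 * s by lia.
have lt_0 : Ordinal lt0 < sigma (Ordinal lt0).
  by have := sigma_neq (Ordinal lt0); rewrite -val_eqE /=; lia.
exists (tnth F (Ordinal lt0)), (Ordinal lt0), (sigma (Ordinal lt0)).
split; rewrite ?F_sigma //; first by rewrite DE // D_eq.
by case; split.
Qed.
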